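(* Let $G=(V,E)$ be a finite weighted graph with edge weights $\mu$, and let $\Omega\subset V$ be nonempty, such that $\widetilde{\Omega}$ is connected and $\delta\Omega$ has at least two vertices. Let $\lambda_1(\Omega)$ be the first nontrivial eigenvalue of the Dirichlet-to-Neumann operator $\Lambda$ on $\Omega$. Then $$\lambda_1(\Omega)\geq\frac{1}{8}\bigl(\zeta_1(\widetilde{\Omega})\bigr)^2,$$ where $\zeta_1(\widetilde{\Omega})$ is the first nontrivial eigenvalue of the (normalized) Laplace operator with no boundary condition on $\widetilde{\Omega}$.
   Context: $V$ is a finite set and $\mu:V\times V\to[0,\infty)$, $(x,y)\mapsto\mu_{xy}=\mu_{yx}$, is a symmetric weight function; $\{x,y\}\in E$ (written $x\sim y$) iff $\mu_{xy}>0$. Self-loops are allowed. For $\Omega_1,\Omega_2\subset V$, $E(\Omega_1,\Omega_2)=\{\{x,y\}\in E: x\in\Omega_1,y\in\Omega_2\}$. The vertex boundary is $\delta\Omega=\{x\in V\setminus\Omega: x\sim y\text{ for some }y\in\Omega\}$, and $\overline{\Omega}=\Omega\cup\delta\Omega$. The graph $\widetilde{\Omega}$ has vertex set $\overline{\Omega}$ and edge set $E(\Omega,\overline{\Omega})$. The measure $m:\overline{\Omega}\to(0,\infty)$ is $m_x=\sum_{y\in V,\,y\sim x}\mu_{xy}$ for $x\in\Omega$ and $m_x=\sum_{y\in\Omega,\,y\sim x}\mu_{xy}$ for $x\in\delta\Omega$. For $f:\overline{\Omega}\to\mathbb{R}$: $\Delta f(x)=\frac1{m_x}\sum_{y\sim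 x}\mu_{xy}(f(y)-f(x))$ for $x\in\Omega$, and $\frac{\partial f}{\partial n}(z)=\frac1{m_z}\sum_{x\in\Omega,\,x\sim z}\mu_{zx}(f(z)-f(x))$ for $z\in\delta\Omega$. For $\varphi:\delta\Omega\to\mathbb{R}$, $u_\varphi:\overline{\Omega}\to\mathbb{R}$ is the unique function with $\Delta u_\varphi=0$ on $\Omega$ and $u_\varphi=\varphi$ on $\delta\Omega$. The Dirichlet-to-Neumann operator is $\Lambda:\mathbb{R}^{\delta\Omega}\to\mathbb{R}^{\delta\Omega}$, $\Lambda\varphi=\frac{\partial u_\varphi}{\partial n}$; it is self-adjoint and nonnegative for $\langle\varphi,\psi\rangle_{\delta\Omega}=\sum_{x\in\delta\Omega}\varphi(x)\psi(x)m_x$, with eigenvalues $0=\lambda_0(\Omega)<\lambda_1(\Omega)\le\cdots$ listed with multiplicity. The Laplace operator with no boundary condition on $\widetilde{\Omega}$ is, with the nonnegative sign convention for its eigenvalues, $(Lf)(x)=\frac1{m_x}\sum_{y:\{x,y\}\in E(\Omega,\overline{\Omega})}\mu_{xy}(f(x)-f(y))$ for $f:\overline{\Omega}\to\mathbb{R}$ and all $x\in\overline{\Omega}$; its eigenvalues are $0=\zeta_0<\zeta_1(\widetilde{\Omega})\le\cdots$ listed with multiplicity. *)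

(* Defs.v *)
From mathcomp Require Import all_boot all_order all_algebra.
From mathcomp Require Import polyrcf.
From mathcomp Require Import boolp classical_sets reals.

Set Implicit Arguments.
Unset Strict Implicit.
Unset Printing Implicit Defensive.

Import Order.TTheory GRing.Theory Num.Theory.
Import passmx.
Local Open Scope ring_scope.

Section Spectrum.
Variables (R : rcfType) (vT : vectType R).

(* The eigenvalues are the roots of the characteristic polynomial; each one is
   repeated according to the dimension of its eigenspace.  [linfun T] agrees
   with [T] as soon as [T] is linear. *)
Definition eigenvalues (T : vT -> vT) : seq R :=
  let e := vbasis {:vT} in
  flatten [seq nseq (\dim (leigenspace (linfun T) a)) a
             | a <- rootsR (char_poly (mxof e e (linfun T)))].

Lemma eigenvalues_sorted (T : vT -> vT) : sorted <=%R (eigenvalues T).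
Proof.
rewrite /eigenvalues; set p := char_poly _.
pose d a := \dim (leigenspace (linfun T) a).
rewrite -[flatten _]/(flatten [seq nseq (d a) a | a <- rootsR p]).
have : sorted <%R (rootsR p) by exact: sorted_roots.
rewrite lt_sorted_pairwise le_sorted_pairwise.
elim: (rootsR p) => //= a s IHs /andP[/allP lt_a /IHs le_s].
rewrite pairwise_cat le_s andbT; apply/andP; split.
  apply/allrelP => x y /nseqP[-> _] /flatten_mapP[b bs /nseqP[-> _]].
  exact/ltW/lt_a.
elim: (d a) => //= n ->; rewrite andbT.
by apply/allP => y /nseqP[-> _].
Qed.

Lemma count_eigenvalues (T : vT -> vT) (a : R) :
  count_mem a (eigenvalues T) = \dim (leigenspace (linfun T) a).
Proof.
rewrite /eigenvalues; set e := vbasis _; set p := char_poly _.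
have eB : basis_of {:vT} e by exact: vbasisP.
rewrite count_flatten -map_comp.
have -> : sumn [seq (count_mem a \o
     (fun b => nseq (\dim (leigenspace (linfun T) b)) b)) b | b <- rootsR p]
   = (\sum_(b <- rootsR p | b == a) \dim (leigenspace (linfun T) b))%N.
  rewrite sumnE big_map [RHS]big_mkcond; apply: eq_bigr => b _ /=.
  by rewrite count_nseq /=; case: eqP => _; rewrite ?mul1n ?mul0n.
have p0 : p != 0 by apply/monic_neq0/char_poly_monic.
have [ra|nra] := boolP (a \in rootsR p).
  by rewrite big_mkcond (bigD1_seq a) ?uniq_roots//= eqxx big1 ?addn0// => b /negPf->.
rewrite big_mkcond big1_seq => [|b /= bp]; last first.
  by case: eqP => // ba; rewrite -ba bp in nra.
apply/esym/eqP; rewrite dimv_eq0; apply: contraNT nra => nz.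
have := roots_on_rootsR p0 a; rewrite in_itv /= => <-.
rewrite -eigenvalue_root_char; apply: contraNneq nz.
rewrite (leigenspaceE eB) => ->.
by apply/eqP; rewrite -[RHS](vsof0 eB).
Qed.

End Spectrum.

Section WeightedGraph.
Variables (R : realType) (V : finType) (mu : V -> V -> R).

Definition adj : rel V := fun x y => 0 < mu x y.

(* Unordered edges; a self-loop at [x] is the singleton [set x; x]. *)
Definition edges (A B : {set V}) : {set {set V}} :=
  [set [set x; y] | x in A, y in B & adj x y].

Definition vertex_boundary (Omega : {set V}) : {set V} :=
  [set x in ~: Omega | [exists y in Omega, adj x y]].

Definition vertex_closure (Omega : {set V}) : {set V} :=
  Omega :|: vertex_boundary Omega.

Variable Omega : {set V}.

Definition bdryT := {x : V | x \in vertex_boundary Omega}.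
Definition closT := {x : V | x \in vertex_closure Omega}.

Lemma bdry_clos_subproof (z : bdryT) : val z \in vertex_closure Omega.
Proof. by rewrite inE (valP z) orbT. Qed.

Definition bdry_clos (z : bdryT) : closT :=
  exist _ (val z) (bdry_clos_subproof z).

Definition tilde_adj : rel closT :=
  fun x y => [set val x; val y] \in edges Omega (vertex_closure Omega).

Definition tilde_connected : Prop := forall x y : closT, connect tilde_adj x y.

Definition measure_at (x : V) : R :=
  if x \in Omega then \sum_(y | adj x y) mu x y
  else \sum_(y in Omega | adj x y) mu x y.

(* [R^o] rather than [R] so that these are vector spaces over [R]. *)
Definition bdry_fun := {ffun bdryT -> R^o}.
Definition clos_fun := {ffun closT -> R^o}.

(* Meant for symmetric [mu] and [val x \in Omega]: every neighbour of [x] is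
   then in the closure. *)
Definition Delta (f : clos_fun) (x : closT) : R :=
  (measure_at (val x))^-1 *
  \sum_(y : closT | adj (val x) (val y)) mu (val x) (val y) * (f y - f x).

Definition normal_derivative (f : clos_fun) (z : bdryT) : R :=
  (measure_at (val z))^-1 *
  \sum_(x : closT | (val x \in Omega) && adj (val x) (val z))
     mu (val z) (val x) * (f (bdry_clos z) - f x).

Definition is_harmonic_extension (phi : bdry_fun) (u : clos_fun) : Prop :=
  (forall x : closT, val x \in Omega -> Delta u x = 0) /\
  (forall z : bdryT, u (bdry_clos z) = phi z).

(* The unique harmonic extension; the default value 0 is not reached when
   [mu] is symmetric and nonnegative, [tilde_connected] holds and the boundary
   is nonempty. *)
Definition harmonic_extension (phi : bdry_fun) : clos_fun :=
  xget 0 [set u | is_harmonic_extension phi u]%classic.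

Definition DtN (phi : bdry_fun) : bdry_fun :=
  [ffun z => normal_derivative (harmonic_extension phi) z].

Definition tilde_laplacian (f : clos_fun) : clos_fun :=
  [ffun x => (measure_at (val x))^-1 *
     \sum_(y : closT | tilde_adj x y) mu (val x) (val y) * (f x - f y)].

(* Eigenvalues are indexed from 0, in nondecreasing order. *)
Definition lambda (k : nat) : R := (eigenvalues DtN)`_k.
Definition zeta (k : nat) : R := (eigenvalues tilde_laplacian)`_k.

End WeightedGraph.

(* Main.v *)
From HB Require Import structures.
Require Import Defs.
From mathcomp Require Import all_boot all_order all_algebra.
From mathcomp Require Import complex spectral ring lra.
From mathcomp Require Import reals.
From mathcomp Require boolp classical_sets.

Import Order.TTheory GRing.Theory Num.Theory.
Local Open Scope ring_scope.

(* In fact [zeta_1 <= lambda_1].  Let [phi] be an eigenfunction of the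
   Dirichlet-to-Neumann operator for [lambda_1] and [u] its harmonic extension.
   By Green's formula the Dirichlet energy of [u] is [lambda_1] times the
   square norm of [phi] on the boundary.  As [phi] has mean zero on the boundary,
   that square norm is at most the one of [u] minus its mean over the whole
   closure, so that the Rayleigh quotient of the latter is at most [lambda_1].
   Since [0 <= zeta_1 <= 2], [zeta_1 ^ 2 / 8 <= zeta_1 <= lambda_1]. *)

(** * Spectral theory of self-adjoint operators *)

Section SelfAdjoint.
Set Implicit Arguments.
Unset Strict Implicit.

Lemma ffunBE (T : finType) (U : zmodType) (f g : {ffun T -> U}) x :
  (f - g) x = f x - g x.
Proof. by rewrite !ffunE. Qed.

Lemma ffunPE (K : pzRingType) (T : finType) (U : lmodType K) a
    (f g : {ffun T -> U}) x :
  (a *: f + g) x = a *: f x + g x.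
Proof. by rewrite !ffunE. Qed.

(** Over the complex numbers [A] is Hermitian, hence unitarily diagonalisable with real spectrum. In
    an eigenbasis the form is a sum of terms [D 0 i * |g_i|^2], so it would be nonnegative if every
    [D 0 i] were. *)
Lemma symmetric_neg_eigenvector (R : rcfType) n (A : 'M[R]_n) (f : 'rV[R]_n) :
  A^T = A -> (f *m A *m f^T) 0 0 < 0 ->
  exists a, exists2 v : 'rV[R]_n, v *m A = a *: v & (v != 0) && (a < 0).
Proof.
move=> symA; pose toC := real_complex R.
pose AC := map_mx toC A; pose P := spectralmx AC; pose D := spectral_diag AC.
have conj_toC m k (B : 'M[R]_(m, k)) :
    map_mx Num.conj (map_mx toC B) = map_mx toC B.
  by apply/matrixP => i j; rewrite !mxE; exact: conjc_real.
have hermA : AC \is hermsymmx.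
  by apply/is_hermitianmxP; rewrite expr0 scale1r map_trmx symA conj_toC.
have unitP := spectral_unitarymx AC.
have AE : AC = invmx P *m diag_mx D *m P.
  exact/orthomx_spectralP/hermitian_normalmx.
have realD i : D 0 i = toC (complex.Re (D 0 i)).
  have /mxOverP/(_ 0 i) := hermitian_spectral_diag_real hermA.
  by rewrite -/D => /Creal_ReP {1}<-; rewrite -complexRe.
(* Row [i] of the unitary matrix [P] is an eigenvector of [AC]; its eigenvalue is real, hence
   already an eigenvalue of [A]. *)
have eigD i : eigenvalue A (complex.Re (D 0 i)).
  suff: eigenvalue AC (D 0 i) by rewrite realD eigenvalue_map.
  apply/eigenvalueP.
  exists (row i P).
    rewrite -row_mul -/AC AE !mulmxA mulmxV ?spectral_unit// mul1mx.
    by apply/rowP => j; rewrite mul_diag_mx !mxE.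
  apply/negP => /eqP /(congr1 (fun u => u *m invmx P)).
  rewrite -row_mul mulmxV ?spectral_unit// mul0mx row1 => /rowP /(_ i).
  by rewrite !mxE !eqxx => /eqP; rewrite oner_eq0.
have [/existsP[i Di_lt0] _|/existsPn noneg] :=
    boolP [exists i, complex.Re (D 0 i) < 0].
  have /eigenvalueP[v vA v0] := eigD i.
  by exists (complex.Re (D 0 i)), v; rewrite ?v0.
rewrite ltNge => /negP[].
rewrite -lecR -/toC.
have -> : toC ((f *m A *m f^T) 0 0) =
    (map_mx toC f *m AC *m map_mx Num.conj (map_mx toC f)^T) 0 0.
  by rewrite map_trmx conj_toC -!map_mxM !mxE.
rewrite AE invmx_unitary// !mulmxA.
(* [g] holds the coordinates of [f] in the eigenbasis. *)
set g := _ *m P^t*%sesqui.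
have -> : g *m diag_mx D *m P *m map_mx Num.conj (map_mx toC f)^T =
    g *m diag_mx D *m g^t*%sesqui.
  by rewrite /g trmx_mul map_mxM trmxCK !mulmxA.
rewrite mxE sumr_ge0// => i _.
rewrite mul_mx_diag !mxE mulrAC mulr_ge0 ?mul_conjC_ge0//.
by rewrite realD lecR leNgt noneg.
Qed.

(** * Sorted eigenvalue lists *)

Section EigenvalueList.
Import passmx.
Variables (R : rcfType) (vT : vectType R) (S : {linear vT -> vT}).

Lemma memv_leigenspace a v : (v \in leigenspace (linfun S) a) = (S v == a *: v).
Proof.
by rewrite memv_ker add_lfunE opp_lfunE scale_lfunE id_lfunE lfunE subr_eq0.
Qed.

Lemma eigenvaluesP a :
  a \in eigenvalues S <-> exists2 v, v != 0 & S v = a *: v.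
Proof.
rewrite -has_pred1 has_count count_eigenvalues lt0n dimv_eq0.
split=> [nz|[v v0 Sv]].
  exists (vpick (leigenspace (linfun S) a)); first by rewrite vpick0.
  by apply/eqP; rewrite -memv_leigenspace memv_pick.
apply: contraNneq v0 => E0; rewrite -memv0 -E0 memv_leigenspace.
exact/eqP.
Qed.

(** As the kernel is a line, 0 has multiplicity one, and nonnegativity puts it at the head of the
    sorted list. Index 1 thus holds the least positive eigenvalue, or the default 0 if [s] is
    empty. *)
Lemma eigenvalues_simple_kernel e :
    (forall a v, v != 0 -> S v = a *: v -> 0 <= a) ->
    e != 0 -> (forall v, S v = 0 <-> v \in <[e]>%VS) ->
  exists2 s, eigenvalues S = 0 :: s & sorted <=%R s /\ {in s, forall a, 0 < a}.
Proof.
move=> S_ge0 e0 kerS.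
have s_ge0 : {in eigenvalues S, forall a, 0 <= a}.
  by move=> a /eigenvaluesP[v v0 /S_ge0]; exact.
have : count_mem 0 (eigenvalues S) = 1%N.
  rewrite count_eigenvalues; have -> : leigenspace (linfun S) 0 = <[e]>%VS.
    apply/vspaceP => v; rewrite memv_leigenspace scale0r.
    by apply/eqP/idP => /kerS.
  by rewrite dim_vline e0.
have := eigenvalues_sorted S; case: (eigenvalues S) s_ge0 => // a s s_ge0 ss.
have sorted_s : sorted <=%R s by exact: path_sorted ss.
have [->|a0] := eqVneq a 0.
  rewrite /= eqxx => -[/eqP]; rewrite -leqn0 leqNgt -has_count => /hasPn s0.
  exists s => //; split=> // b bs; rewrite lt0r s0//=.
  by rewrite s_ge0// inE bs orbT.
(* With a nonzero head [a], 0 would occur later in the sorted list, so [a <= 0], against [0 <= a]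
   and [a != 0]. *)
rewrite /= (negPf a0) add0n => s1.
have : 0 \in s by rewrite -has_pred1 has_count s1.
move: ss; rewrite /= le_path_sortedE => /andP[/allP le_as _] /le_as a_le0.
by move: a0; rewrite eq_le a_le0 s_ge0 ?mem_head.
Qed.

End EigenvalueList.

(** * Weighted inner products and the variational bound on the second eigenvalue *)

Section WeightedDot.
Variables (R : rcfType) (T : finType) (m : T -> R).
Local Notation F := {ffun T -> R^o}.
Implicit Types f g h : F.

Definition wdot (f g : F) : R := \sum_x m x * ((f x : R) * (g x : R)).

Lemma wdotC f g : wdot f g = wdot g f.
Proof. by apply: eq_bigr => x _; rewrite (mulrC (f x : R)). Qed.

Lemma wdotDl f g h : wdot (f + g) h = wdot f h + wdot g h.
Proof.
rewrite -big_split; apply: eq_bigr => x _; rewrite ffunE /=.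
by rewrite mulrDl mulrDr.
Qed.

Lemma wdotZl a f g : wdot (a *: f) g = a * wdot f g.
Proof.
rewrite mulr_sumr; apply: eq_bigr => x _; rewrite ffunE /=.
by rewrite -[_ *: _]/(a * (f x : R)); ring.
Qed.

Lemma wdotBl f g h : wdot (f - g) h = wdot f h - wdot g h.
Proof. by rewrite wdotDl -scaleN1r wdotZl mulN1r. Qed.

Lemma wdotBr f g h : wdot f (g - h) = wdot f g - wdot f h.
Proof. by rewrite wdotC wdotBl !(wdotC f). Qed.

Lemma wdotZr a f g : wdot f (a *: g) = a * wdot f g.
Proof. by rewrite wdotC wdotZl wdotC. Qed.

Lemma wdot0l f : wdot 0 f = 0.
Proof. by rewrite /wdot big1// => x _; rewrite ffunE mul0r mulr0. Qed.

Lemma wdot0r f : wdot f 0 = 0.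
Proof. by rewrite wdotC wdot0l. Qed.

Hypothesis m_gt0 : forall x, 0 < m x.

Lemma wdot_ge0 f : 0 <= wdot f f.
Proof. by apply: sumr_ge0 => x _; rewrite mulr_ge0 ?(ltW (m_gt0 x))// -expr2 sqr_ge0. Qed.

Lemma wdot_gt0 f : f != 0 -> 0 < wdot f f.
Proof.
move=> f0; rewrite lt0r wdot_ge0 andbT; apply: contraNneq f0 => /eqP.
rewrite psumr_eq0 => [/allP f0|x _]; last first.
  by rewrite mulr_ge0 ?(ltW (m_gt0 x))// -expr2 sqr_ge0.
apply/eqP/ffunP => x; rewrite ffunE; apply/eqP.
by have := f0 x (mem_index_enum _); rewrite !mulf_eq0 (gt_eqF (m_gt0 x)) orbb.
Qed.

(* With [m = s^2], conjugating by multiplication by [s] turns a self-adjoint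
   operator into a symmetric matrix. *)
Lemma selfadjoint_neg_eigenvector (S : {linear F -> F}) (f : F) :
    (forall f g, wdot (S f) g = wdot f (S g)) -> wdot (S f) f < 0 ->
  exists a, exists2 v : F, S v = a *: v & (v != 0) && (a < 0).
Proof.
move=> SA.
pose s x := Num.sqrt (m x).
have s_neq0 x : s x != 0 by rewrite gt_eqF// sqrtr_gt0.
have sqr_s x : s x * s x = m x by rewrite -expr2 sqr_sqrtr ?ltW.
pose delta y : F := [ffun x => (x == y)%:R].
have wdot_delta g y : wdot g (delta y) = m y * (g y : R).
  rewrite /wdot (bigD1 y)//= big1 => [|x /negPf xy]; rewrite ffunE.
    by rewrite eqxx mulr1 addr0.
  by rewrite xy !mulr0.
pose K x y := wdot (S (delta x)) (delta y).
pose A : 'M[R]_#|T| := \matrix_(i, j)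
  (K (enum_val i) (enum_val j) / (s (enum_val i) * s (enum_val j))).
pose hat (v : 'rV[R]_#|T|) : F := [ffun x => v 0 (enum_rank x) / s x].
have symA : A^T = A.
  apply/matrixP => i j; rewrite !mxE (mulrC (s _)) /K SA wdotC.
  by [].
(* Equivalently [hat (v *m A) = S (hat v)]: [hat] carries eigenvectors of [A] to eigenvectors of
   [S]. *)
have hatA v j : (v *m A) 0 j = s (enum_val j) * (S (hat v) (enum_val j) : R).
  have -> : hat v = \sum_x (hat v x : R) *: delta x.
    apply/ffunP => x; rewrite sum_ffunE (bigD1 x)//= big1 => [|y yx].
      by rewrite !ffunE eqxx addr0 /= -[_ *: _]/(_ * _) mulr1.
    by rewrite !ffunE eq_sym (negPf yx) scaler0.
  rewrite linear_sum sum_ffunE mulr_sumr mxE (reindex enum_rank); last first.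
    by apply: onW_bij; exact: enum_rank_bij.
  apply: eq_bigr => x _; rewrite linearZ !mxE !ffunE enum_rankK.
  rewrite /K wdot_delta -[_ *: _]/(_ * _) -sqr_s.
  by field; rewrite !s_neq0.
(* [g] is the preimage of [f] under [hat]; the form of [A] at [g] equals [wdot (S f) f]. *)
move=> Sf_lt0; pose g : 'rV[R]_#|T| := \row_i (s (enum_val i) * f (enum_val i)).
have hatg : hat g = f.
  by apply/ffunP => x; rewrite ffunE mxE enum_rankK mulrAC divff ?mul1r.
have [|a [v vA /andP[v0 a0]]] := @symmetric_neg_eigenvector _ _ A g symA.
  rewrite mxE; apply: le_lt_trans Sf_lt0.
  rewrite (reindex enum_rank); last by apply: onW_bij; exact: enum_rank_bij.
  rewrite le_eqVlt; apply/orP; left; apply/eqP/eq_bigr => x _.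
  rewrite hatA hatg !mxE !enum_rankK -sqr_s; ring.
exists a, (hat v).
  apply/ffunP => x; have := hatA v (enum_rank x).
  rewrite vA mxE enum_rankK !ffunE -[_ *: _]/(_ * _) mulrA => ->.
  by rewrite mulrAC divff ?mul1r.
rewrite a0 andbT; apply: contra v0 => /eqP v0; apply/eqP/rowP => i.
have /eqP := congr1 (fun h : F => h (enum_val i) : R) v0.
rewrite !ffunE enum_valK mulf_eq0 invr_eq0 (negPf (s_neq0 _)) orbF mxE.
by move=> /eqP.
Qed.

Section SimpleKernel.
Variables (S : {linear F -> F}) (e : F).
Hypotheses (S_sa : forall f g, wdot (S f) g = wdot f (S g))
  (S_ge0 : forall f, 0 <= wdot (S f) f)
  (e0 : e != 0) (kerS : forall f, S f = 0 <-> f \in <[e]>%VS).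

Let eig_ge0 a f : f != 0 -> S f = a *: f -> 0 <= a.
Proof.
move=> f0 Sf; have := S_ge0 f; rewrite Sf wdotZl pmulr_lge0//.
exact: wdot_gt0.
Qed.

Lemma second_eigenvalue_ge0 : 0 <= (eigenvalues S)`_1.
Proof.
have [s -> [_ s_gt0]] := eigenvalues_simple_kernel eig_ge0 e0 kerS.
by case: s s_gt0 => //= a s /(_ a (mem_head _ _)) /ltW.
Qed.

(** The form of [-S] is negative at [f], so [-S] has a negative eigenvalue and [S] a positive one.
    Hence the list has a true second entry, and index 1 does not fall on the default 0. *)
Lemma second_eigenvector f : 0 < wdot (S f) f ->
  exists2 g : F, g != 0 & S g = (eigenvalues S)`_1 *: g /\ 0 < (eigenvalues S)`_1.
Proof.
move=> Sf_gt0; pose negS : {linear F -> F} := -%R \o S.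
have [||a [g negSg /andP[g0 a0]]] := @selfadjoint_neg_eigenvector negS f.
- by move=> g h; rewrite /= -!scaleN1r wdotZl wdotZr S_sa.
- by rewrite /= -scaleN1r wdotZl mulN1r oppr_lt0.
have : - a \in eigenvalues S.
  by apply/eigenvaluesP; exists g => //; rewrite scaleNr -negSg /= opprK.
have [s sE [_ s_gt0]] := eigenvalues_simple_kernel eig_ge0 e0 kerS.
rewrite sE inE oppr_eq0 (lt_eqF a0) /= => as_.
case: s as_ sE s_gt0 => // b s _ sE /(_ b (mem_head _ _)) b_gt0.
have /eigenvaluesP[h h0 Sh] : b \in eigenvalues S by rewrite sE !inE eqxx orbT.
by exists h; rewrite // sE.
Qed.

(* Otherwise [S - z (1 - P)], with [P] the projection to the kernel, would have
   a negative eigenvalue, whose eigenvector is orthogonal to the kernel and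
   gives an eigenvalue of [S] in [0, z). *)
Lemma second_eigenvalue_le f : wdot f e = 0 ->
  (eigenvalues S)`_1 * wdot f f <= wdot (S f) f.
Proof.
move=> fe; set z := (eigenvalues S)`_1.
have ee_gt0 := wdot_gt0 e0.
have Se : S e = 0 by apply/kerS; exact: memv_line.
pose P (g : F) : F := (wdot g e / wdot e e) *: e.
pose Z g := S g - z *: (g - P g).
have P_linear : linear P.
  by move=> a g h; rewrite /P wdotDl wdotZl scalerA -scalerDl mulrDl mulrA.
have Z_linear : linear Z.
  move=> a g h; rewrite /Z linearP P_linear !scalerBr !scalerDr !scalerA.
  rewrite (mulrC a z) !opprB.
  by rewrite [in RHS]addrACA; congr (_ + _); rewrite addrACA -!addrA opprD.
pose Zlin : {linear F -> F} := HB.pack Z (GRing.isLinear.Build _ _ _ _ Z Z_linear).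
rewrite leNgt; apply/negP => lt_fz.
have P_sa g h : wdot (P g) h = wdot g (P h).
  by rewrite wdotZl wdotZr (wdotC e); ring.
have [||a [g Zg /andP[g0 a0]]] := @selfadjoint_neg_eigenvector Zlin f.
- move=> g h; rewrite /= /Z wdotBl wdotBr S_sa; congr (_ - _).
  by rewrite wdotZl wdotZr wdotBl wdotBr P_sa.
- rewrite /= /Z /P fe mul0r scale0r subr0 wdotBl wdotZl.
  by rewrite subr_lt0.
(* Pair [Z g = a *: g] with [e]: both [S g] and [g - P g] are orthogonal to [e], so
   [a * wdot g e = 0] with [a < 0]. *)
have ge : wdot g e = 0.
  have := congr1 (wdot^~ e) Zg.
  rewrite /= /Z wdotBl S_sa Se wdot0r sub0r.
  rewrite -mulN1r !wdotZl wdotBl wdotZl divfK ?gt_eqF// subrr !mulr0.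
  by move=> /esym/eqP; rewrite mulf_eq0 (lt_eqF a0) => /eqP.
have Sg : S g = (a + z) *: g.
  have := Zg; rewrite /= /Z /P ge mul0r scale0r subr0 => /eqP.
  by rewrite subr_eq -scalerDl => /eqP.
(* Otherwise [g] would lie in the kernel, on the line of [e], and be orthogonal to itself. *)
have az_neq0 : a + z != 0.
  apply: contraTneq (wdot_gt0 g0) => az0.
  have /vlineP[k gE] : g \in <[e]>%VS by apply/kerS; rewrite Sg az0 scale0r.
  by rewrite {2}gE wdotZr ge mulr0 ltxx.
have : a + z \in eigenvalues S by apply/eigenvaluesP; exists g.
have [s sE [sorted_s s_gt0]] := eigenvalues_simple_kernel eig_ge0 e0 kerS.
rewrite sE inE (negPf az_neq0) /=.
(* If the tail is empty, no nonzero eigenvalue exists. Otherwise [z] is its head [b], a lower bound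
   of the tail, while [a + z < z]. *)
move: sE sorted_s; rewrite /z; case: s {s_gt0} => //= b s -> /=.
rewrite le_path_sortedE => /andP[/allP le_bs _]; rewrite inE => /orP[/eqP|/le_bs].
  by move=> /eqP; rewrite -subr_eq0 addrK (lt_eqF a0).
by rewrite lerDr leNgt a0.
Qed.

End SimpleKernel.

End WeightedDot.

End SelfAdjoint.

(** * The Laplacian of a connected weighted graph *)

Section Laplacian.
Set Implicit Arguments.
Unset Strict Implicit.
Variables (R : rcfType) (T : finType) (w : T -> T -> R).
Local Notation F := {ffun T -> R^o}.
Implicit Types f g : F.
Let m x := \sum_y w x y.

Definition laplacian f : F :=
  [ffun x => (m x)^-1 * \sum_y w x y * ((f x : R) - (f y : R))].

Lemma laplacian_linear : linear laplacian.
Proof.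
have scaleE (b c : R) : b *: (c : R^o) = b * c by [].
move=> a f g; apply/ffunP => x; rewrite !ffunE !scaleE.
rewrite mulrCA -mulrDr; congr (_ * _).
rewrite mulr_sumr -big_split; apply: eq_bigr => y _.
rewrite !ffunE !scaleE /=; ring.
Qed.
HB.instance Definition _ := GRing.isLinear.Build _ _ _ _ laplacian laplacian_linear.

Hypotheses (w_ge0 : forall x y, 0 <= w x y) (w_sym : forall x y, w x y = w y x)
  (m_gt0 : forall x, 0 < m x).

Lemma mul_laplacian f x :
  m x * (laplacian f x : R) = \sum_y w x y * ((f x : R) - (f y : R)).
Proof. by rewrite ffunE mulrA divff ?mul1r ?gt_eqF. Qed.

(** Exchanging [x] and [y] in the double sum and using the symmetry of [w] gives a second expression
    of the left side; the Dirichlet form is the average of the two. *)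
Lemma laplacian_energy f g : wdot m (laplacian f) g =
  2^-1 * \sum_x \sum_y w x y * (((f x : R) - f y) * ((g x : R) - g y)).
Proof.
have E : wdot m (laplacian f) g =
    \sum_x \sum_y w x y * ((f x : R) - (f y : R)) * (g x : R).
  apply: eq_bigr => x _; rewrite mulrA mul_laplacian mulr_suml.
  by [].
have E' : wdot m (laplacian f) g =
    \sum_x \sum_y - (w x y * ((f x : R) - (f y : R)) * (g y : R)).
  rewrite E exchange_big; apply: eq_bigr => x _; apply: eq_bigr => y _.
  rewrite w_sym; ring.
suff -> : \sum_x \sum_y w x y * (((f x : R) - f y) * ((g x : R) - g y)) =
    wdot m (laplacian f) g + wdot m (laplacian f) g by field.
rewrite {1}E E' -big_split; apply: eq_bigr => x _.
rewrite -big_split; apply: eq_bigr => y _ /=; ring.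
Qed.

Lemma laplacian_sa f g : wdot m (laplacian f) g = wdot m f (laplacian g).
Proof.
rewrite [RHS]wdotC !laplacian_energy; congr (_ * _).
by apply: eq_bigr => x _; apply: eq_bigr => y _; rewrite (mulrC (f x - f y : R)).
Qed.

Lemma laplacian_ge0 f : 0 <= wdot m (laplacian f) f.
Proof.
rewrite laplacian_energy mulr_ge0 ?invr_ge0// sumr_ge0// => x _.
by rewrite sumr_ge0// => y _; rewrite mulr_ge0// -expr2 sqr_ge0.
Qed.

(** Edge by edge, [(a - b)^2 <= 2 (a^2 + b^2)]; the double sum of [a^2 + b^2] is twice the square
    norm, and the energy carries a factor [2^-1]. *)
Lemma laplacian_le2 f : wdot m (laplacian f) f <= 2 * wdot m f f.
Proof.
have E : wdot m f f = \sum_x \sum_y w x y * ((f x : R) * f x).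
  by apply: eq_bigr => x _; rewrite mulr_suml.
have E' : wdot m f f = \sum_x \sum_y w x y * ((f y : R) * f y).
  rewrite E exchange_big; apply: eq_bigr => x _; apply: eq_bigr => y _.
  by rewrite w_sym.
rewrite mulr_natl mulr2n {1}E E' -big_split laplacian_energy mulr_sumr.
apply: ler_sum => x _; rewrite -big_split mulr_sumr.
apply: ler_sum => y _; rewrite /= -mulrDr mulrCA ler_wpM2l//.
have := sqr_ge0 ((f x : R) + f y); rewrite expr2; lra.
Qed.

(** Every term of the energy is nonnegative, hence zero, so [f] agrees across each edge of positive
    weight and then along paths. *)
Lemma laplacian_energy_eq0 f x y :
  wdot m (laplacian f) f = 0 -> connect (fun x y => 0 < w x y) x y -> f x = f y.
Proof.
rewrite laplacian_energy => /eqP; rewrite mulf_eq0 invr_eq0 pnatr_eq0 /=.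
have t_ge0 a b : 0 <= w a b * (((f a : R) - f b) * ((f a : R) - f b)).
  by rewrite mulr_ge0// -expr2 sqr_ge0.
rewrite psumr_eq0 => [/allP E0|a _]; last by rewrite sumr_ge0.
have edge a b : 0 < w a b -> f a = f b.
  move=> wab; have /eqP/psumr_eq0P := E0 a (mem_index_enum _).
  move=> /(_ (fun b _ => t_ge0 a b)) /(_ b isT) /eqP.
  by rewrite !mulf_eq0 (gt_eqF wab) orbb subr_eq0 => /eqP.
move=> /connectP[p]; elim: p x => [|z p IH] x /=; first by move=> _ ->.
by move=> /andP[/edge -> /IH] /[apply].
Qed.

Let one : F := [ffun=> 1].

Lemma laplacian1 : laplacian one = 0.
Proof.
apply/ffunP => x; rewrite !ffunE big1 ?mulr0// => y _.
by rewrite !ffunE subrr mulr0.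
Qed.

Hypothesis w_conn : forall x y, connect (fun x y => 0 < w x y) x y.

Lemma laplacian_ker f : laplacian f = 0 <-> f \in <[one]>%VS.
Proof.
split=> [f0|/vlineP[k ->]]; last by rewrite linearZ /= laplacian1 scaler0.
have [x0 _|T0] := pickP T; last first.
  suff -> : f = 0 by rewrite mem0v.
  by apply/ffunP => x; have := T0 x.
apply/vlineP; exists (f x0); apply/ffunP => x.
rewrite !ffunE -[_ *: _]/(_ * _) mulr1; apply: laplacian_energy_eq0 => //.
by rewrite f0 wdot0l.
Qed.

Lemma second_laplacian_eigenvalue_ge0 : 0 <= (eigenvalues laplacian)`_1.
Proof.
have [x0 _|T0] := pickP T.
  apply: (second_eigenvalue_ge0 m_gt0 laplacian_ge0 _ laplacian_ker).
  by apply/eqP => /(congr1 (fun h : F => h x0)) /eqP; rewrite !ffunE oner_eq0.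
(* On an empty vertex set the function space is zero, so there is no eigenvalue and the default 0 is
   read. *)
case E: (eigenvalues laplacian) => [|a s] //=.
have /eigenvaluesP[f /eqP[]] : a \in eigenvalues laplacian.
  by rewrite E mem_head.
by apply/ffunP => x; have := T0 x.
Qed.

Lemma second_laplacian_eigenvalue_le2 : (eigenvalues laplacian)`_1 <= 2.
Proof.
have [s1|s1] := ltnP 1 (size (eigenvalues laplacian)); last by rewrite nth_default.
have /eigenvaluesP[f f0 Lf] := mem_nth 0 s1.
have := laplacian_le2 f.
by rewrite Lf wdotZl ler_pM2r ?(wdot_gt0 m_gt0 f0).
Qed.

(* Subtracting from [f] its mean over [T] preserves the energy and, as [f] has
   mean zero on [B], can only increase the square norm on [B]. *)
Lemma second_laplacian_eigenvalue_le (B : pred T) f :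
    \sum_(x | B x) m x * (f x : R) = 0 ->
  (eigenvalues laplacian)`_1 * (\sum_(x | B x) m x * ((f x : R) * f x)) <=
  wdot m (laplacian f) f.
Proof.
move=> fB; have [f0|f_neq0] := eqVneq f 0.
  rewrite big1 ?mulr0; first exact: laplacian_ge0.
  by move=> x _; rewrite f0 ffunE !mulr0.
have one0 : one != 0.
  apply: contraNneq f_neq0 => one0; apply/eqP/ffunP => x.
  by have /eqP := congr1 (fun h : F => h x) one0; rewrite !ffunE oner_eq0.
have one_gt0 := wdot_gt0 m_gt0 one0.
pose c := wdot m f one / wdot m one one; pose h := f - c *: one.
have h1 : wdot m h one = 0 by rewrite wdotBl wdotZl divfK ?gt_eqF// subrr.
have Lh : laplacian h = laplacian f.
  by rewrite linearB linearZ /= laplacian1 scaler0 subr0.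
have <- : wdot m (laplacian h) h = wdot m (laplacian f) f.
  by rewrite Lh wdotBr wdotZr [wdot _ _ one]laplacian_sa laplacian1
    wdot0r mulr0 subr0.
apply: le_trans (second_eigenvalue_le m_gt0 laplacian_sa laplacian_ge0 one0
  laplacian_ker h1).
rewrite ler_wpM2l ?second_laplacian_eigenvalue_ge0//.
(* With [h = f - c], one has [h^2 - c^2 = f^2 - 2 c f], and the linear term sums to zero over [B] by
   [fB]. *)
have -> : \sum_(x | B x) m x * ((f x : R) * f x) =
    \sum_(x | B x) (m x * ((h x : R) * h x) - m x * (c * c)).
  transitivity (\sum_(x | B x) m x * ((f x : R) * f x) +
      - (2 * c) * (\sum_(x | B x) m x * (f x : R))).
    by rewrite fB mulr0 addr0.
  rewrite mulr_sumr -big_split; apply: eq_bigr => x _.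
  rewrite !ffunE /= -[_ *: _]/(_ * _); ring.
rewrite /wdot [leRHS](bigID B) /= ler_wpDr ?sumr_ge0// => [x _|].
  by rewrite mulr_ge0 ?(ltW (m_gt0 x))// -expr2 sqr_ge0.
apply: ler_sum => x _; rewrite lerBlDr lerDl.
by rewrite mulr_ge0 ?(ltW (m_gt0 x))// -expr2 sqr_ge0.
Qed.

End Laplacian.

(** * The Dirichlet-to-Neumann operator and its comparison with the Laplacian *)

Section DirichletToNeumann.
Set Implicit Arguments.
Unset Strict Implicit.
Variables (R : realType) (V : finType) (mu : V -> V -> R) (Omega : {set V}).
Hypotheses (mu_ge0 : forall x y, 0 <= mu x y)
  (mu_sym : forall x y, mu x y = mu y x).
Local Notation closT := (closT mu Omega).
Local Notation bdryT := (bdryT mu Omega).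
Local Notation iota := (@bdry_clos R V mu Omega).
Implicit Types (phi psi : bdry_fun mu Omega) (u v : clos_fun mu Omega).

(** Dropping the weights between boundary vertices makes [tilde_laplacian], [Delta] (up to sign) and
    [normal_derivative] all values of one Laplacian. *)
Definition tilde_weight (x y : closT) : R :=
  if tilde_adj x y then mu (val x) (val y) else 0.
Local Notation w := tilde_weight.
Let m x := \sum_y w x y.
Local Notation L := (laplacian tilde_weight).

Lemma tilde_adjE (x y : closT) : tilde_adj x y =
  adj mu (val x) (val y) && ((val x \in Omega) || (val y \in Omega)).
Proof.
apply/imset2P/andP => [[a b aO]|[xy O]].
  (* Equality of the unordered pairs is used through the membership of each endpoint in the other
     pair, which also covers self-loops. *)
  rewrite inE => /andP[bO ab] /setP E.
  have: (val x \in [set a; b]) && (val y \in [set a; b]).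
    by rewrite -!E !inE !eqxx orbT.
  have: (a \in [set val x; val y]) && (b \in [set val x; val y]).
    by rewrite !E !inE !eqxx orbT.
  have ba : adj mu b a by rewrite /adj mu_sym.
  move: aO ab ba; rewrite !inE; move: (val x) (val y) => p q {E} aO ab ba.
  by move=> /andP[/orP[]/eqP ? /orP[]/eqP ?] /andP[/orP[]/eqP ? /orP[]/eqP ?];
    subst; rewrite aO ?orbT.
have yx : adj mu (val y) (val x) by rewrite /adj mu_sym.
case: (boolP (val x \in Omega)) O => /= [xO _|_ yO].
  by exists (val x) (val y); rewrite // inE (valP y).
exists (val y) (val x); [exact: yO | by rewrite inE (valP x) | exact: setUC].
Qed.

Lemma tilde_weight_ge0 x y : 0 <= w x y.
Proof. by rewrite /w; case: ifP. Qed.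

Lemma tilde_weight_sym x y : w x y = w y x.
Proof. by rewrite /w !tilde_adjE /adj mu_sym (orbC (val x \in _)). Qed.

Lemma tilde_weight_gt0 x y : (0 < w x y) = tilde_adj x y.
Proof.
rewrite /w; case: ifPn => [|_]; last by rewrite ltxx.
by rewrite tilde_adjE => /andP[].
Qed.

Lemma bdry_notin (z : bdryT) : val z \in Omega = false.
Proof. by have := valP z; rewrite !inE => /andP[/negPf]. Qed.

(** All neighbours of a vertex of [Omega] lie in the closure, and a boundary vertex keeps only its
    edges into [Omega]. *)
Lemma measure_atE (x : closT) : measure_at mu Omega (val x) = m x.
Proof.
rewrite /measure_at /m; case: ifPn => xO.
  rewrite (eq_bigl (fun y => (y \in vertex_closure mu Omega) && adj mu (val x) y)).
    rewrite big_sub_cond big_mkcond; apply: eq_bigr => y _.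
    by rewrite /w tilde_adjE xO andbT.
  move=> y; rewrite !inE; case xy: (adj mu (val x) y); rewrite ?andbF// andbT.
  case: (boolP (y \in Omega)) => //= _.
  by apply/esym/existsP; exists (val x); rewrite xO /adj mu_sym.
rewrite (eq_bigl (fun y => (y \in vertex_closure mu Omega) &&
    (adj mu (val x) y && (y \in Omega)))).
  rewrite big_sub_cond big_mkcond; apply: eq_bigr => y _.
  by rewrite /w tilde_adjE (negPf xO).
by move=> y; rewrite !inE; case: (y \in Omega); rewrite ?andbF ?andbT.
Qed.

Lemma tilde_laplacianE : @tilde_laplacian R V mu Omega =1 L.
Proof.
move=> f; apply/ffunP => x; rewrite !ffunE measure_atE; congr (_ * _).
rewrite big_mkcond; apply: eq_bigr => y _.
by rewrite /w; case: ifP => // _; rewrite mul0r.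
Qed.

Lemma DeltaE u (x : closT) : val x \in Omega -> Delta u x = - (L u x : R).
Proof.
move=> xO; rewrite ffunE /Delta measure_atE -mulrN -sumrN; congr (_ * _).
rewrite big_mkcond; apply: eq_bigr => y _; rewrite /w tilde_adjE xO andbT.
case: ifP => _; ring.
Qed.

Lemma normal_derivativeE u (z : bdryT) : normal_derivative u z = L u (iota z).
Proof.
rewrite ffunE /normal_derivative -[val z]/(val (iota z)) measure_atE.
congr (_ * _); rewrite big_mkcond; apply: eq_bigr => y _.
rewrite /w tilde_adjE /= bdry_notin /= andbC /adj mu_sym.
by case: ifP => _; rewrite ?mul0r.
Qed.

Lemma sum_bdry (F : closT -> R) :
  \sum_(x | val x \notin Omega) F x = \sum_z F (iota z).
Proof.
rewrite (reindex_omap iota (fun x => insub (val x))) => [|x xO].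
  apply: eq_bigl => z; rewrite /= bdry_notin /=.
  by rewrite insubT ?(valP z)// => zP; apply/eqP; congr Some; apply: val_inj.
have xB : val x \in vertex_boundary mu Omega.
  by have := valP x; rewrite inE (negPf xO).
by rewrite insubT /=; congr Some; apply: val_inj.
Qed.

Lemma is_harmonic_extensionE phi u : is_harmonic_extension phi u <->
  (forall x, val x \in Omega -> L u x = 0) /\ (forall z, u (iota z) = phi z).
Proof.
split=> -[hu bu]; split=> // x xO.
  by have /eqP := hu x xO; rewrite DeltaE// oppr_eq0 => /eqP.
by rewrite DeltaE// hu// oppr0.
Qed.

Hypotheses (conn : tilde_connected mu Omega)
  (bdry_ge2 : (2 <= #|vertex_boundary mu Omega|)%N).

Lemma weight_connected (x y : closT) : connect (fun x y => 0 < w x y) x y.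
Proof.
by rewrite (eq_connect (e' := @tilde_adj R V mu Omega)) ?conn// => a b;
  rewrite tilde_weight_gt0.
Qed.

Lemma bdry_neq : exists z1 z2 : bdryT, z1 != z2.
Proof.
have /card_gt1P[a [b [aB bB ab]]] := bdry_ge2.
by exists (exist _ a aB), (exist _ b bB).
Qed.

Lemma iota_inj : injective iota.
Proof. by move=> a b /(congr1 val) /= ab; apply: val_inj. Qed.

(** The closure has a vertex other than [x], and the first edge of a path to it has positive
    weight. *)
Lemma tilde_measure_gt0 (x : closT) : 0 < m x.
Proof.
have [y xy] : exists y, x != y.
  have [z1 [z2 z12]] := bdry_neq.
  have [->|] := eqVneq x (iota z1); last by exists (iota z1).
  by exists (iota z2); rewrite (inj_eq iota_inj).
have /connectP[[|z p] /=] := weight_connected x y.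
  by move=> _ yx; rewrite yx eqxx in xy.
move=> /andP[xz _] _; rewrite /m (bigD1 z)//= ltr_wpDr// sumr_ge0// => t _.
exact: tilde_weight_ge0.
Qed.

Let m_gt0 := tilde_measure_gt0.
Let w_ge0 := tilde_weight_ge0.
Let w_sym := tilde_weight_sym.

Lemma green (u v : clos_fun mu Omega) :
    (forall x, val x \in Omega -> (L u x : R) * (v x : R) = 0) ->
  wdot m (L u) v = \sum_z m (iota z) * ((L u (iota z) : R) * (v (iota z) : R)).
Proof.
move=> uv; rewrite -(sum_bdry (fun x => m x * ((L u x : R) * (v x : R)))).
rewrite /wdot (bigID (fun x => val x \in Omega)) /= big1 ?add0r//.
by move=> x xO; rewrite uv// mulr0.
Qed.

(** By Green's formula [u] has zero energy, so it is constant along a path to a boundary vertex,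
    where it vanishes. *)
Lemma harmonic_eq0 (u : clos_fun mu Omega) :
    (forall x, val x \in Omega -> L u x = 0) -> (forall z, u (iota z) = 0) ->
  u = 0.
Proof.
move=> hu bu; have [z0 _] := bdry_neq.
apply/ffunP => x; rewrite ffunE -(bu z0).
apply: (laplacian_energy_eq0 w_ge0 w_sym m_gt0) (weight_connected x (iota z0)).
rewrite green => [|y yO]; last by rewrite hu// mul0r.
by rewrite big1// => z _; rewrite bu !mulr0.
Qed.

(* The Dirichlet problem is a square linear system, so that uniqueness implies
   existence. *)
Lemma harmonic_extensionP phi :
  is_harmonic_extension phi (harmonic_extension phi).
Proof.
apply: classical_sets.xgetPex.
(* [Psi u = g] encodes the whole Dirichlet problem: the equation inside [Omega], the boundary values
   outside. *)
pose Psi (u : clos_fun mu Omega) : clos_fun mu Omega :=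
  [ffun x => if val x \in Omega then L u x else u x].
have Psi_linear : linear Psi.
  move=> a u v; apply/ffunP => x; rewrite /Psi ffunE.
  by case: ifP => xO; rewrite ?linearP !ffunE /= xO.
pose P : {linear _ -> _} := HB.pack Psi (GRing.isLinear.Build _ _ _ _ Psi Psi_linear).
have kerP : lker (linfun P) == 0%VS.
  rewrite -subv0; apply/subvP => u; rewrite memv_ker lfunE /= => /eqP Pu.
  rewrite memv0; apply/eqP/harmonic_eq0 => [x xO|z].
    by have := congr1 (fun h : clos_fun mu Omega => h x) Pu; rewrite ffunE xO [RHS]ffunE.
  have := congr1 (fun h : clos_fun mu Omega => h (iota z)) Pu.
  by rewrite ffunE /= bdry_notin [RHS]ffunE.
(* The right-hand side is [phi] on the boundary, extended by 0 to [Omega]. *)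
pose g : clos_fun mu Omega := [ffun x => oapp phi 0 (insub (val x) : option bdryT)].
pose u := ((linfun P)^-1)%VF g.
have Pu : Psi u = g by rewrite -[Psi u]/(P u) -lfunE lker0_lfunVK.
exists u; apply/is_harmonic_extensionE; split=> [x xO|z].
  have := congr1 (fun h : clos_fun mu Omega => h x) Pu; rewrite !ffunE xO => ->.
  by rewrite insubN// !inE xO.
have := congr1 (fun h : clos_fun mu Omega => h (iota z)) Pu.
rewrite !ffunE /= bdry_notin => ->.
by rewrite insubT ?(valP z)// => zP /=; congr (phi _); apply: val_inj.
Qed.

Lemma harmonic_extension_unique phi u :
  is_harmonic_extension phi u -> u = harmonic_extension phi.
Proof.
move=> /is_harmonic_extensionE[hu bu].
have /is_harmonic_extensionE[hE bE] := harmonic_extensionP phi.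
apply/eqP; rewrite -subr_eq0; apply/eqP/harmonic_eq0 => [x xO|z].
  by rewrite linearB ffunBE /= hu// hE// subrr.
by rewrite ffunBE bu bE subrr.
Qed.

Local Notation ext := (@harmonic_extension R V mu Omega).

Lemma harmonic_extension_linear : linear ext.
Proof.
move=> a f g; apply/esym/harmonic_extension_unique/is_harmonic_extensionE.
have /is_harmonic_extensionE[hf bf] := harmonic_extensionP f.
have /is_harmonic_extensionE[hg bg] := harmonic_extensionP g.
split=> [x xO|z]; last by rewrite !ffunPE bf bg.
by rewrite linearP ffunPE /= hf// hg// scaler0 addr0.
Qed.

Local Notation DtN := (@DtN R V mu Omega).

Lemma DtNE phi z : DtN phi z = L (ext phi) (iota z).
Proof. by rewrite ffunE normal_derivativeE. Qed.

Lemma DtN_linear : linear DtN.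
Proof.
move=> a f g; apply/ffunP => z; rewrite ffunPE !DtNE.
by rewrite harmonic_extension_linear linearP /= ffunPE.
Qed.

Let mb (z : bdryT) := m (iota z).

(** Harmonicity kills the interior terms of Green's formula. Self-adjointness, nonnegativity and the
    kernel of [DtN] are deduced from this identity. *)
Lemma DtN_green phi psi : wdot mb (DtN phi) psi = wdot m (L (ext phi)) (ext psi).
Proof.
have /is_harmonic_extensionE[hf bf] := harmonic_extensionP phi.
have /is_harmonic_extensionE[hg bg] := harmonic_extensionP psi.
rewrite green => [|x xO]; last by rewrite hf// mul0r.
by apply: eq_bigr => z _; rewrite bg DtNE.
Qed.

Lemma DtN_sa phi psi : wdot mb (DtN phi) psi = wdot mb phi (DtN psi).
Proof.
by rewrite [RHS]wdotC !DtN_green (laplacian_sa w_sym m_gt0) wdotC.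
Qed.

Lemma DtN_ge0 phi : 0 <= wdot mb (DtN phi) phi.
Proof. by rewrite DtN_green (laplacian_ge0 w_ge0 w_sym m_gt0). Qed.

Lemma DtN_energy_eq0 phi (y z : bdryT) :
  wdot mb (DtN phi) phi = 0 -> phi y = phi z.
Proof.
have /is_harmonic_extensionE[_ bf] := harmonic_extensionP phi.
rewrite DtN_green -!bf => E0.
exact: (laplacian_energy_eq0 w_ge0 w_sym m_gt0 E0 (weight_connected _ _)).
Qed.

Let one : bdry_fun mu Omega := [ffun=> 1].

Lemma DtN1 : DtN one = 0.
Proof.
have oneE : [ffun=> 1] = ext one.
  apply/harmonic_extension_unique/is_harmonic_extensionE.
  by split=> [x xO|z]; rewrite ?laplacian1 !ffunE.
by apply/ffunP => z; rewrite DtNE -oneE laplacian1 !ffunE.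
Qed.

Lemma DtN_ker phi : DtN phi = 0 <-> phi \in <[one]>%VS.
Proof.
pose D : {linear _ -> _} := HB.pack DtN (GRing.isLinear.Build _ _ _ _ DtN DtN_linear).
split=> [f0|/vlineP[k ->]]; last first.
  by rewrite -[DtN _]/(D _) linearZ /= DtN1 scaler0.
have [z0 _] := bdry_neq.
apply/vlineP; exists (phi z0); apply/ffunP => z.
rewrite !ffunE -[_ *: _]/(_ * _) mulr1; apply: DtN_energy_eq0 => //.
by rewrite f0 wdot0l.
Qed.

Lemma zetaE : zeta mu Omega 1 = (eigenvalues L)`_1.
Proof.
by rewrite /zeta; congr (_ _)`_1; apply/boolp.funext; exact: tilde_laplacianE.
Qed.

Lemma zeta_bounds : 0 <= zeta mu Omega 1 <= 2.
Proof.
rewrite zetaE (second_laplacian_eigenvalue_le2 w_ge0 w_sym m_gt0) andbT.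
exact: (second_laplacian_eigenvalue_ge0 w_ge0 w_sym m_gt0 weight_connected).
Qed.

Lemma zeta_le_lambda : zeta mu Omega 1 <= lambda mu Omega 1.
Proof.
rewrite zetaE.
pose D : {linear _ -> _} := HB.pack DtN (GRing.isLinear.Build _ _ _ _ DtN DtN_linear).
have [z1 [z2 z12]] := bdry_neq.
have mb_gt0 z : 0 < mb z by exact: m_gt0.
have one0 : one != 0.
  by apply/eqP => /(congr1 (fun h : bdry_fun mu Omega => h z1)) /eqP;
    rewrite !ffunE oner_eq0.
(* The indicator of [z1] differs at [z2], so its energy is positive; this makes [lambda mu Omega 1]
   a genuine positive eigenvalue. *)
pose psi : bdry_fun mu Omega := [ffun z => (z == z1)%:R].
have psi_gt0 : 0 < wdot mb (D psi) psi.
  rewrite lt0r DtN_ge0 andbT; apply: contraNneq z12 => /(@DtN_energy_eq0 _ z1 z2).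
  by rewrite !ffunE eqxx eq_sym; case: eqP => // _ /eqP; rewrite oner_eq0.
have [phi phi0 [Dphi lambda_gt0]] :=
  @second_eigenvector _ _ _ mb_gt0 D one DtN_sa DtN_ge0 one0 DtN_ker psi psi_gt0.
rewrite -/(lambda mu Omega 1) in Dphi lambda_gt0.
(* An eigenfunction for a nonzero eigenvalue is orthogonal to the constants, which form the
   kernel. *)
have phi1 : wdot mb phi one = 0.
  have : wdot mb (D phi) one = 0 by rewrite [LHS]DtN_sa DtN1 wdot0r.
  by rewrite Dphi wdotZl => /eqP; rewrite mulf_eq0 (gt_eqF lambda_gt0) => /eqP.
have /is_harmonic_extensionE[_ bf] := harmonic_extensionP phi.
have bdry0 : \sum_(x : closT | val x \notin Omega) m x * (ext phi x : R) = 0.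
  rewrite (sum_bdry (fun x => m x * (ext phi x : R))) -[RHS]phi1.
  by apply: eq_bigr => z _; rewrite ffunE mulr1 bf.
(* Here [B] is the boundary and the function is the extension of [phi]. Its energy is
   [lambda mu Omega 1] times the square norm of [phi], a positive factor that cancels. *)
have := second_laplacian_eigenvalue_le w_ge0 w_sym m_gt0 weight_connected bdry0.
rewrite -DtN_green -[DtN _]/(D phi) Dphi wdotZl.
rewrite (sum_bdry (fun x => m x * ((ext phi x : R) * (ext phi x : R)))).
rewrite (eq_bigr (fun z => mb z * ((phi z : R) * phi z))) => [|z _].
  by rewrite ler_pM2r ?(wdot_gt0 mb_gt0 phi0).
by rewrite bf.
Qed.

End DirichletToNeumann.

Theorem corollary1p1 (R : realType) (V : finType) (mu : V -> V -> R)
    (mu_ge0 : forall x y : V, 0 <= mu x y)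
    (mu_sym : forall x y : V, mu x y = mu y x)
    (Omega : {set V}) (Omega_neq0 : Omega != set0)
    (Omega_conn : tilde_connected mu Omega)
    (bdry_ge2 : (2 <= #|vertex_boundary mu Omega|)%N) :
  lambda mu Omega 1 >= 8%:R^-1 * (zeta mu Omega 1) ^+ 2.
Proof.
have zl := zeta_le_lambda mu_ge0 mu_sym Omega_conn bdry_ge2.
have /andP[z0 z2] := zeta_bounds mu_ge0 mu_sym Omega_conn bdry_ge2.
apply: le_trans zl; nra.
Qed.
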